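(* The Banach lattice $E=c_0(\ell_2^n)=\left(\bigoplus_{n=1}^\infty \ell_2^n\right)_0$ does not have the weak Grothendieck property and does not have the positive Grothendieck property.
   Context: For each $n\ge 1$, $\ell_2^n$ is $\mathbb{R}^n$ with the Euclidean norm and coordinatewise order. $E=\left(\bigoplus_{n=1}^\infty \ell_2^n\right)_0$ is the space of sequences $x=(x_n)_n$ with $x_n\in\ell_2^n$ and $\|x_n\|_2\to 0$, with norm $\sup_n\|x_n\|_2$ and coordinatewise order. Its dual is $E'=\left(\bigoplus_n \ell_2^n\right)_1$ (norm $\sum_n\|x_n\|_2$), and its bidual is $E''=\left(\bigoplus_n \ell_2^n\right)_\infty$ (norm $\sup_n\|x_n\|_2$), with coordinatewise orders and natural pairings. In a Banach lattice, a sequence $(x_n)$ is disjoint if $|x_n|\wedge|x_m|=0$ for all $n\ne m$. A Banach lattice $F$ has the weak Grothendieck property if every disjoint weak* null sequence in $F'$ is weakly null; it has the positive Grothendieck property if every weak* null sequence of positive elements of $F'$ is weakly null. *)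

(* Defs.v *)
From HB Require Import structures.
From mathcomp Require Import all_boot all_order all_algebra.
From mathcomp Require Import all_classical all_reals all_analysis.
From mathcomp Require Import ring lra.

Set Implicit Arguments.
Unset Strict Implicit.
Unset Printing Implicit Defensive.

Import Order.TTheory GRing.Theory Num.Theory.
Import numFieldNormedType.Exports.

Local Open Scope classical_set_scope.
Local Open Scope ring_scope.

(* The order is part of the mixin instead of being inherited from
   [Order.Lattice]: every MathComp structure that joins lattice orders with
   additive groups is already a [realDomainType], and Hierarchy Builder does not
   accept a new join of [Order.Lattice] and [CompleteNormedModule] beside it. *)
HB.mixin Record isBanachLattice (R : realType) (E : Type)
    of CompleteNormedModule R E := {
  ble : E -> E -> Prop ;
  bmeet : E -> E -> E ;
  bjoin : E -> E -> E ;
  blexx : forall x, ble x x ;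
  ble_anti : forall x y, ble x y -> ble y x -> x = y ;
  ble_trans : forall y x z, ble x y -> ble y z -> ble x z ;
  blexI : forall x y z, ble z (bmeet x y) <-> ble z x /\ ble z y ;
  bleUx : forall x y z, ble (bjoin x y) z <-> ble x z /\ ble y z ;
  bleD2r : forall z x y, ble x y -> ble (x + z) (y + z) ;
  bscale_ge0 : forall (a : R) x, 0 <= a -> ble 0 x -> ble 0 (a *: x) ;
  ble_norm : forall x y, ble (bjoin x (- x)) (bjoin y (- y)) -> `|x| <= `|y|
}.

#[short(type="banachLatticeType")]
HB.structure Definition BanachLattice (R : realType) :=
  {E of CompleteNormedModule R E & isBanachLattice R E}.

Notation "x [<=] y" := (ble x y) (at level 70, no associativity).
Notation "x [/\] y" := (bmeet x y) (at level 48, left associativity).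
Notation "x [\/] y" := (bjoin x y) (at level 52, left associativity).

Definition lat_abs (R : realType) (E : banachLatticeType R) (x : E) : E :=
  x [\/] (- x).

Section BanachLatticeTheory.
Context {R : realType} {E : banachLatticeType R}.
Implicit Types (x y z : E) (a : R).

Lemma bleUl x y : x [<=] x [\/] y.
Proof. by have [] := (bleUx x y (x [\/] y)).1 (blexx _). Qed.

Lemma bleUr x y : y [<=] x [\/] y.
Proof. by have [] := (bleUx x y (x [\/] y)).1 (blexx _). Qed.

Lemma bleIl x y : x [/\] y [<=] x.
Proof. by have [] := (blexI x y (x [/\] y)).1 (blexx _). Qed.

Lemma bleIr x y : x [/\] y [<=] y.
Proof. by have [] := (blexI x y (x [/\] y)).1 (blexx _). Qed.

Lemma bleD x y z t : x [<=] y -> z [<=] t -> (x + z) [<=] (y + t).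
Proof.
move=> xy zt; apply: (@ble_trans _ _ (y + z)); first exact: bleD2r.
by rewrite ![y + _]addrC; exact: bleD2r.
Qed.

Lemma bsubr_ge0 x y : 0 [<=] (y - x) <-> x [<=] y.
Proof.
by split => [/(bleD2r x)|/(bleD2r (- x))]; rewrite ?add0r ?subrK ?subrr.
Qed.

Lemma baddr_ge0 x y : 0 [<=] x -> 0 [<=] y -> 0 [<=] (x + y).
Proof. by move=> x0 y0; rewrite -[0]addr0; exact: bleD. Qed.

Lemma bleN2 x y : (- x) [<=] (- y) <-> y [<=] x.
Proof. by rewrite -bsubr_ge0 opprK addrC bsubr_ge0. Qed.

Lemma lat_abs_ge0 x : 0 [<=] lat_abs x.
Proof.
have := bleD (bleUl x (- x)) (bleUr x (- x)).
rewrite subrr -mulr2n -scaler_nat => h.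
have : 0 [<=] (2^-1 : R) *: (2%:R *: (x [\/] - x)).
  by apply: bscale_ge0 => //; rewrite invr_ge0.
by rewrite scalerA mulVf ?pnatr_eq0// scale1r.
Qed.

Lemma ge0_lat_abs x : 0 [<=] x -> lat_abs x = x.
Proof.
move=> x0; apply: ble_anti; last exact: bleUl.
apply/bleUx; split; first exact: blexx.
by apply: (@ble_trans _ _ 0) => //; rewrite -oppr0; apply/bleN2.
Qed.

Lemma ble_ge0_norm x y : 0 [<=] x -> x [<=] y -> `|x| <= `|y|.
Proof.
move=> x0 xy; apply: ble_norm; rewrite -!/(lat_abs _).
by rewrite !ge0_lat_abs//; exact: ble_trans xy.
Qed.

Lemma norm_lat_abs x : `|lat_abs x| = `|x|.
Proof.
have h := ge0_lat_abs (lat_abs_ge0 x).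
by apply/eqP; rewrite eq_le; apply/andP; split; apply: ble_norm;
  rewrite -!/(lat_abs _) h; exact: blexx.
Qed.

Definition lat_pos x : E := x [\/] 0.

Lemma lat_pos_ge0 x : 0 [<=] lat_pos x. Proof. exact: bleUr. Qed.

Lemma lat_pos_sub_ge0 x : 0 [<=] (lat_pos x - x).
Proof. by apply/bsubr_ge0; exact: bleUl. Qed.

Lemma norm_lat_pos x : `|lat_pos x| <= `|x|.
Proof.
rewrite -(norm_lat_abs x); apply: ble_ge0_norm; first exact: lat_pos_ge0.
by apply/bleUx; split; [exact: bleUl|exact: lat_abs_ge0].
Qed.

Lemma lat_pos_decomp x : x = lat_pos x - (lat_pos x - x).
Proof. by rewrite opprB addrC subrK. Qed.

Lemma lat_decomp x : exists u v, [/\ 0 [<=] u, 0 [<=] v & x = u - v].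
Proof.
exists (lat_pos x), (lat_pos x - x); split; last exact: lat_pos_decomp.
- exact: lat_pos_ge0.
- exact: lat_pos_sub_ge0.
Qed.

Lemma riesz_decomp x y z : 0 [<=] z -> z [<=] (x + y) ->
  0 [<=] x -> 0 [<=] y ->
  exists z1 z2, [/\ z = z1 + z2, 0 [<=] z1, z1 [<=] x, 0 [<=] z2 & z2 [<=] y].
Proof.
move=> z0 zxy x0 y0; exists (z [/\] x), (z - (z [/\] x)).
split.
- by rewrite addrC subrK.
- exact/blexI.
- exact: bleIr.
- by apply/bsubr_ge0; exact: bleIl.
- have : (z - y) [<=] (z [/\] x).
    apply/blexI; split.
      by apply/bsubr_ge0; rewrite opprB addrC subrK.
    by apply/bsubr_ge0; rewrite opprB addrA; exact/bsubr_ge0.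
  move/(bleD2r (y - (z [/\] x))).
  by rewrite addrA subrK [_ + (y - _)]addrC subrK.
Qed.

End BanachLatticeTheory.

Record topdual (R : realType) (V : normedModType R) := Topdual {
  topdual_fun :> {linear V -> R^o} ;
  topdual_continuous : continuous topdual_fun }.

Section TopDualModule.
Context {R : realType} {V : normedModType R}.
Implicit Types (f g h : topdual V) (x y : V).

HB.instance Definition _ := gen_eqMixin (topdual V).
HB.instance Definition _ := gen_choiceMixin (topdual V).

Lemma topdual_ext f g : (forall x, f x = g x) -> f = g.
Proof.
move=> fg; have {}fg : (f : V -> R^o) = g by exact/funext.
case: f g fg => [[f Pf] cf] [[g Pg] cg] /= fg.
subst g.
have EP : Pf = Pg.
  case: Pf {cf} => [[a1] [a2]]; case: Pg {cg} => [[b1] [b2]].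
  by rewrite (Prop_irrelevance a1 b1) (Prop_irrelevance a2 b2).
subst Pg; by rewrite (Prop_irrelevance cf cg).
Qed.

Lemma linear_continuousP (f : {linear V -> R^o}) :
  continuous f <-> exists C : R, forall x, `|f x| <= C * `|x|.
Proof.
rewrite -linear_bounded_continuous linear_boundedP; split.
  by move=> /pinfty_ex_gt0[C _ fC]; exists C.
move=> [C fC]; exists C; split; first exact: num_real.
by move=> r Cr x; rewrite (le_trans (fC x))// ler_wpM2r// ltW.
Qed.

Fact topdual_zero_continuous : continuous (\0 : V -> R^o).
Proof. by move=> x; exact: cvg_cst. Qed.

Fact topdual_add_continuous f g : continuous (f \+ g).
Proof.
by move=> x; apply: cvgD; exact: topdual_continuous.
Qed.

Fact topdual_opp_continuous f : continuous (\- f).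
Proof. by move=> x; apply: cvgN; exact: topdual_continuous. Qed.

Fact topdual_scale_continuous (a : R) f : continuous (a \*: f).
Proof. by move=> x; apply: cvgZr; exact: topdual_continuous. Qed.

Definition topdual_zero := Topdual topdual_zero_continuous.
Definition topdual_add f g := Topdual (@topdual_add_continuous f g).
Definition topdual_opp f := Topdual (@topdual_opp_continuous f).
Definition topdual_scale a f := Topdual (@topdual_scale_continuous a f).

Fact topdual_addA : associative topdual_add.
Proof. by move=> f g h; apply: topdual_ext => x; exact: addrA. Qed.
Fact topdual_addC : commutative topdual_add.
Proof. by move=> f g; apply: topdual_ext => x; exact: addrC. Qed.
Fact topdual_add0 : left_id topdual_zero topdual_add.
Proof. by move=> f; apply: topdual_ext => x; exact: add0r. Qed.
Fact topdual_addN : left_inverse topdual_zero topdual_opp topdual_add.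
Proof. by move=> f; apply: topdual_ext => x; exact: addNr. Qed.

HB.instance Definition _ := GRing.isZmodule.Build (topdual V)
  topdual_addA topdual_addC topdual_add0 topdual_addN.

Fact topdual_scaleA a b f :
  topdual_scale a (topdual_scale b f) = topdual_scale (a * b) f.
Proof. by apply: topdual_ext => x; exact: scalerA. Qed.
Fact topdual_scale1 : left_id 1 topdual_scale.
Proof. by move=> f; apply: topdual_ext => x; exact: scale1r. Qed.
Fact topdual_scaleDr : right_distributive topdual_scale +%R.
Proof. by move=> a f g; apply: topdual_ext => x; exact: scalerDr. Qed.
Fact topdual_scaleDl f : {morph topdual_scale^~ f : a b / a + b}.
Proof. by move=> a b; apply: topdual_ext => x; exact: scalerDl. Qed.

HB.instance Definition _ := GRing.Zmodule_isLmodule.Build R (topdual V)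
  topdual_scaleA topdual_scale1 topdual_scaleDr topdual_scaleDl.

Lemma topdualDE f g x : (f + g) x = f x + g x. Proof. by []. Qed.
Lemma topdualNE f x : (- f) x = - f x. Proof. by []. Qed.
Lemma topdualZE a f x : (a *: f) x = a * f x. Proof. by []. Qed.
Lemma topdual0E x : (0 : topdual V) x = 0. Proof. by []. Qed.

Definition opnorm f : R := sup [set `|f x| | x in [set x | `|x| <= 1]].

Lemma opnorm_has_sup f : has_sup [set `|f x| | x in [set x | `|x| <= 1]].
Proof.
split; first by exists `|f 0|, 0 => //=; rewrite normr0.
have [C fC] := (linear_continuousP f).1 (@topdual_continuous _ _ f).
exists `|C| => _ /= [x x1 <-].
rewrite (le_trans (fC x))// (le_trans (ler_norm _))// normrM normr_id.
by rewrite ler_piMr.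
Qed.

Lemma opnorm_ub f x : `|f x| <= opnorm f * `|x|.
Proof.
have [->|x0] := eqVneq x 0; first by rewrite linear0 !normr0 mulr0.
have nx0 : 0 < `|x| by rewrite normr_gt0.
rewrite -ler_pdivrMr//.
have -> : `|f x| / `|x| = `|f (`|x|^-1 *: x)|.
  by rewrite linearZ/= normrZ normfV normr_id mulrC.
apply: (sup_upper_bound (opnorm_has_sup f)) => /=.
by exists (`|x|^-1 *: x) => //=; rewrite normfZV.
Qed.

Lemma opnorm_le f C : 0 <= C -> (forall x, `|f x| <= C * `|x|) -> opnorm f <= C.
Proof.
move=> C0 fC; apply: ge_sup; first by case: (opnorm_has_sup f).
move=> _ /= [x x1 <-]; rewrite (le_trans (fC x))//.
by rewrite ler_piMr.
Qed.

Lemma opnorm_ge0 f : 0 <= opnorm f.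
Proof.
apply: le_trans (normr_ge0 (f 0)) _.
by apply: (sup_upper_bound (opnorm_has_sup f)) => /=; exists 0; rewrite //= normr0.
Qed.

Fact opnormD f g : opnorm (f + g) <= opnorm f + opnorm g.
Proof.
apply: opnorm_le => [|x]; first by rewrite addr_ge0// opnorm_ge0.
by rewrite topdualDE mulrDl (le_trans (ler_normD _ _))// lerD// opnorm_ub.
Qed.

Fact opnorm_eq0 f : opnorm f = 0 -> f = 0.
Proof.
move=> f0; apply: topdual_ext => x; apply/eqP.
by rewrite -normr_le0 -(mul0r `|x|) -f0 opnorm_ub.
Qed.

Fact opnormZ a f : opnorm (a *: f) = `|a| * opnorm f.
Proof.
have H b g : opnorm (b *: g) <= `|b| * opnorm g.
  apply: opnorm_le => [|x]; first by rewrite mulr_ge0// opnorm_ge0.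
  by rewrite topdualZE normrM -mulrA ler_wpM2l// opnorm_ub.
have [->|a0] := eqVneq a 0.
  apply/eqP; rewrite normr0 mul0r eq_le opnorm_ge0 andbT.
  by rewrite (le_trans (H _ _))// normr0 mul0r.
apply/eqP; rewrite eq_le H/= -ler_pdivlMl ?normr_gt0//.
rewrite -[in leLHS](scale1r f) -(mulVf a0) -scalerA.
by rewrite (le_trans (H _ _))// normfV.
Qed.

HB.instance Definition _ :=
  Lmodule_isNormed.Build R (topdual V) opnormD opnormZ opnorm_eq0.

Lemma topdual_normE f : `|f| = opnorm f. Proof. by []. Qed.

Lemma topdual_norm_ub f x : `|f x| <= `|f| * `|x|.
Proof. exact: opnorm_ub. Qed.

Fact topdual_complete (F : set_system (topdual V)) :
  ProperFilter F -> cauchy F -> cvg F.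
Proof.
move=> FF /cauchy_ballP Fc.
have Fc2 (e : R) : 0 < e -> \forall f \near F, \forall g \near F, `|f - g| < e.
  move=> e0; have := Fc e e0 => /nearP_dep.
  by apply: filterS => f; apply: filterS.
have ptw x : exists l : R, (fun f : topdual V => f x) @ F --> l.
  suff : cvg ((fun f : topdual V => f x) @ F) by move=> /cvg_ex.
  apply/cauchy_cvgP/cauchyP => e e0.
  have d0 : 0 < e / (`|x| + 1) by rewrite divr_gt0// ltr_wpDl.
  have [f Ff] := (cauchyP _).1 ((cauchy_ballP _).1 Fc) _ d0.
  exists (f x); apply: (filterS (P := ball f (e / (`|x| + 1)))) Ff => g fg.
  rewrite /= /ball/= (_ : _ - _ = (f - g) x)//.
  rewrite (le_lt_trans (topdual_norm_ub _ _))//.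
  have : `|f - g| < e / (`|x| + 1) by exact: fg.
  rewrite ltr_pdivlMr ?ltr_wpDl// => /(le_lt_trans _); apply.
  by rewrite ler_wpM2l// lerDl.
have [l lE] := choice ptw.
have llin : linear (l : V -> R^o).
  move=> a x y; apply/esym/(cvg_unique _ _ (lE _)) => /=.
    exact: norm_hausdorff.
  under eq_fun do rewrite linearP.
  by apply: cvgD => //; apply: cvgZr; exact: lE.
pose L : {linear V -> R^o} := HB.pack l (GRing.isLinear.Build _ _ _ _ l llin).
have Lub (e : R) : 0 < e -> \forall f \near F, forall x, `|l x - (f : topdual V) x| <= e * `|x|.
  move=> e0; have := Fc2 _ e0; apply: filterS => f fg x.
  have : (fun g : topdual V => `|g x - f x|) @ F --> `|l x - f x|.
    by apply: cvg_norm; apply: cvgB => //; exact: cvg_cst.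
  move/cvgr_to_le; apply; apply: filterS fg => g fg.
  rewrite distrC (le_trans (topdual_norm_ub (f - g) x))//.
  by rewrite ler_wpM2r// ltW.
have Lcont : continuous L.
  apply/linear_continuousP.
  have [f fl] := @filter_ex _ F _ _ (Lub 1 ltr01).
  exists (1 + `|f|) => x /=; rewrite -(subrK (f x) (l x)) (le_trans (ler_normD _ _))//.
  by rewrite mulrDl lerD// topdual_norm_ub.
apply/cvg_ex; exists (Topdual Lcont); apply/cvgrPdist_le => e e0.
apply: filterS (Lub e e0) => f fL.
by apply: opnorm_le => [|x]; [exact: ltW|exact: fL].
Unshelve. all: by end_near. Qed.

HB.instance Definition _ := Uniform_isComplete.Build (topdual V) topdual_complete.

End TopDualModule.

(* The dual order is determined by the positive cone of [E], and the join is
   given by the Riesz-Kantorovich formula. *)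
Section TopDualLattice.
Context {R : realType} {E : banachLatticeType R}.
Implicit Types (f g h : topdual E) (x y z u v : E).

Definition topdual_le f g : Prop := forall x, 0 [<=] x -> f x <= g x.

Definition rk_set f g x : set R :=
  [set f y + g (x - y) | y in [set y | 0 [<=] y /\ y [<=] x]].

Definition rk_sup f g x : R := sup (rk_set f g x).

Lemma rk_set_bound f g x r : rk_set f g x r -> `|r| <= (`|f| + `|g|) * `|x|.
Proof.
move=> [y [y0 yx] <-]; rewrite (le_trans (ler_normD _ _))// mulrDl lerD//.
  rewrite (le_trans (topdual_norm_ub _ _))// ler_wpM2l//.
  exact: ble_ge0_norm.
rewrite (le_trans (topdual_norm_ub _ _))// ler_wpM2l//.
apply: ble_ge0_norm; first exact/bsubr_ge0.
by apply/bsubr_ge0; rewrite opprB addrC subrK.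
Qed.

Lemma rk_has_sup f g x : 0 [<=] x -> has_sup (rk_set f g x).
Proof.
move=> x0; split.
  by exists (f 0 + g (x - 0)), 0 => //; split => //; exact: blexx.
exists ((`|f| + `|g|) * `|x|) => r /rk_set_bound; exact/le_trans/ler_norm.
Qed.

Lemma rk_sup_ub f g x y : 0 [<=] y -> y [<=] x ->
  f y + g (x - y) <= rk_sup f g x.
Proof.
move=> y0 yx; apply: (sup_upper_bound (rk_has_sup f g _)).
  exact: ble_trans yx.
by exists y.
Qed.

Lemma rk_sup_le f g x c : 0 [<=] x ->
  (forall y, 0 [<=] y -> y [<=] x -> f y + g (x - y) <= c) -> rk_sup f g x <= c.
Proof.
move=> x0 H; apply: ge_sup; first by case: (rk_has_sup f g x0).
by move=> _ [y [y0 yx] <-]; exact: H.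
Qed.

Lemma rk_sup_bound f g x : 0 [<=] x -> `|rk_sup f g x| <= (`|f| + `|g|) * `|x|.
Proof.
move=> x0; rewrite ler_norml; apply/andP; split.
  have S : rk_set f g x (f 0 + g (x - 0)).
    by exists 0 => //; split => //; exact: blexx.
  apply: (le_trans _ (rk_sup_ub f g (blexx _) x0)).
  by have := rk_set_bound S; rewrite ler_norml => /andP[].
apply: rk_sup_le => // y y0 yx; apply: le_trans (ler_norm _) _.
by apply: rk_set_bound; exists y.
Qed.

Lemma rk_supD f g x y : 0 [<=] x -> 0 [<=] y ->
  rk_sup f g (x + y) = rk_sup f g x + rk_sup f g y.
Proof.
move=> x0 y0; apply/eqP; rewrite eq_le; apply/andP; split.
  apply: rk_sup_le => [|z z0 zxy]; first exact: baddr_ge0.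
  have [z1 [z2 [-> z10 z1x z20 z2y]]] := riesz_decomp z0 zxy x0 y0.
  have -> : x + y - (z1 + z2) = (x - z1) + (y - z2) by rewrite opprD addrACA.
  by rewrite (linearD f) (linearD g) addrACA lerD// rk_sup_ub.
rewrite -lerBrDr; apply: rk_sup_le => // z z0 zx.
rewrite lerBrDr addrC -lerBrDr; apply: rk_sup_le => // t t0 ty.
rewrite lerBrDr.
have -> : f t + g (y - t) + (f z + g (x - z)) = f (z + t) + g (x + y - (z + t)).
  by rewrite addrC addrACA -(linearD f) -(linearD g) addrACA -opprD.
by apply: rk_sup_ub; [exact: baddr_ge0|exact: bleD].
Qed.

Lemma rk_sup0 f g : rk_sup f g 0 = 0.
Proof.
have := rk_supD f g (blexx 0) (blexx 0); rewrite addr0 => /eqP.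
by rewrite -subr_eq0 opprD addrA subrr add0r oppr_eq0 => /eqP.
Qed.

Lemma bscale_le (a : R) x y : 0 <= a -> x [<=] y -> (a *: x) [<=] (a *: y).
Proof.
move=> a0 /bsubr_ge0 xy; apply/bsubr_ge0; rewrite -scalerBr.
exact: bscale_ge0.
Qed.

Lemma rk_supZ f g (a : R) x : 0 <= a -> 0 [<=] x ->
  rk_sup f g (a *: x) = a * rk_sup f g x.
Proof.
have H (b : R) y : 0 < b -> 0 [<=] y -> rk_sup f g (b *: y) <= b * rk_sup f g y.
  move=> b0 y0; apply: rk_sup_le => [|z z0 zb].
    by apply: bscale_ge0 => //; exact: ltW.
  have bV : 0 <= b^-1 by rewrite invr_ge0 ltW.
  rewrite -ler_pdivrMl// mulrDr -[_ * f z]/(_ *: f z) -[_ * g _]/(_ *: g _).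
  rewrite -!linearZ/= scalerBr scalerA mulVf ?gt_eqF// scale1r.
  apply: rk_sup_ub; first exact: bscale_ge0.
  by have := bscale_le bV zb; rewrite scalerA mulVf ?gt_eqF// scale1r.
rewrite le_eqVlt => /predU1P[<-|a0] x0; first by rewrite scale0r mul0r rk_sup0.
apply/eqP; rewrite eq_le H//= -ler_pdivlMl//.
have ax0 : 0 [<=] (a *: x) by apply: bscale_ge0 => //; exact: ltW.
have := H a^-1 _ _ ax0; rewrite scalerA mulVf ?gt_eqF// scale1r; apply.
by rewrite invr_gt0.
Qed.

Definition rk_fun f g x : R := rk_sup f g (lat_pos x) - rk_sup f g (lat_pos x - x).

Lemma rk_funB f g u v : 0 [<=] u -> 0 [<=] v ->
  rk_fun f g (u - v) = rk_sup f g u - rk_sup f g v.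
Proof.
move=> u0 v0; set p := lat_pos (u - v).
have p0 : 0 [<=] p by exact: lat_pos_ge0.
have q0 : 0 [<=] (p - (u - v)) by exact: lat_pos_sub_ge0.
have e : rk_sup f g p + rk_sup f g v = rk_sup f g u + rk_sup f g (p - (u - v)).
  by rewrite -!rk_supD// opprB addrCA subrKC addrC.
by rewrite /rk_fun -/p; apply/eqP; rewrite subr_eq addrAC -e addrK.
Qed.

Lemma rk_fun_ge0 f g x : 0 [<=] x -> rk_fun f g x = rk_sup f g x.
Proof.
by move=> x0; rewrite -{1}[x]subr0 rk_funB ?rk_sup0 ?subr0//; exact: blexx.
Qed.

Fact rk_fun_linear f g : linear (rk_fun f g : E -> R^o).
Proof.
move=> a x y; have [u [v [u0 v0 ->]]] := lat_decomp x.
have [s [t [s0 t0 ->]]] := lat_decomp y.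
rewrite -[RHS]/(a * _ + _) !rk_funB//; have [a0|/ltW a0] := leP 0 a.
  have au := bscale_ge0 _ _ a0 u0; have av := bscale_ge0 _ _ a0 v0.
  rewrite scalerBr addrACA -opprD rk_funB; try exact: baddr_ge0.
  by rewrite !rk_supD// !rk_supZ// opprD addrACA mulrBr.
have {a0} : 0 <= - a by rewrite oppr_ge0.
rewrite -{2 3}(opprK a); move: (- a) => b b0.
have -> : - b *: (u - v) + (s - t) = (b *: v + s) - (b *: u + t).
  by rewrite scaleNr scalerBr opprB addrACA opprD.
have bu := bscale_ge0 _ _ b0 u0; have bv := bscale_ge0 _ _ b0 v0.
rewrite rk_funB; try exact: baddr_ge0.
rewrite !rk_supD// !rk_supZ// opprD addrACA; congr (_ + _).
by rewrite mulNr -mulrN opprB mulrBr.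
Qed.

HB.instance Definition _ f g :=
  GRing.isLinear.Build R E R^o *:%R (rk_fun f g) (rk_fun_linear f g).

Fact rk_fun_continuous f g : continuous (rk_fun f g : E -> R^o).
Proof.
apply/linear_continuousP; exists ((`|f| + `|g|) * 3) => x /=.
rewrite (le_trans (ler_normB _ _))//.
rewrite (le_trans (lerD (rk_sup_bound _ _ _) (rk_sup_bound _ _ _)))//.
- exact: lat_pos_ge0.
- exact: lat_pos_sub_ge0.
rewrite -mulrDr -mulrA ler_wpM2l// ?addr_ge0//.
rewrite (_ : 3 * `|x| = `|x| + (`|x| + `|x|)); last first.
  by rewrite -mulr2n -mulrS mulr_natl.
rewrite lerD ?norm_lat_pos// (le_trans (ler_normB _ _))// lerD//.
exact: norm_lat_pos.
Qed.

Definition topdual_join f g : topdual E := Topdual (@rk_fun_continuous f g).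
Definition topdual_meet f g : topdual E := - topdual_join (- f) (- g).

Lemma topdual_joinE f g x : 0 [<=] x -> topdual_join f g x = rk_sup f g x.
Proof. exact: rk_fun_ge0. Qed.

Fact topdual_lexx f : topdual_le f f. Proof. by move=> x _. Qed.

Fact topdual_le_anti f g : topdual_le f g -> topdual_le g f -> f = g.
Proof.
move=> fg gf.
have H x : 0 [<=] x -> f x = g x.
  by move=> x0; apply/eqP; rewrite eq_le fg// gf.
apply: topdual_ext => x; have [u [v [u0 v0 ->]]] := lat_decomp x.
by rewrite !linearB/= !H.
Qed.

Fact topdual_le_trans g f h : topdual_le f g -> topdual_le g h -> topdual_le f h.
Proof. by move=> fg gh x x0; exact: le_trans (fg x x0) (gh x x0). Qed.

Fact topdual_leUx f g h :
  topdual_le (topdual_join f g) h <-> topdual_le f h /\ topdual_le g h.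
Proof.
split=> [H|[fh gh] x x0].
  split=> x x0; apply: le_trans (H x x0); rewrite topdual_joinE//.
    by have := rk_sup_ub f g x0 (blexx _); rewrite subrr linear0 addr0.
  by have := rk_sup_ub f g (blexx _) x0; rewrite subr0 linear0 add0r.
rewrite topdual_joinE//; apply: rk_sup_le => // y y0 yx.
rewrite -[leRHS](_ : h y + h (x - y) = _); last by rewrite -linearD/= addrC subrK.
by apply: lerD; [exact: fh|apply: gh; exact/bsubr_ge0].
Qed.

Fact topdual_lexI f g h :
  topdual_le h (topdual_meet f g) <-> topdual_le h f /\ topdual_le h g.
Proof.
have N f1 f2 : topdual_le (- f1) (- f2) <-> topdual_le f2 f1.
  by split=> H x x0; have := H x x0; rewrite ?topdualNE lerN2.
by rewrite -N opprK topdual_leUx !N.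
Qed.

Fact topdual_leD2r h f g : topdual_le f g -> topdual_le (f + h) (g + h).
Proof. by move=> fg x x0; rewrite !topdualDE lerD2r; exact: fg. Qed.

Fact topdual_scale_ge0 (a : R) f : 0 <= a -> topdual_le 0 f -> topdual_le 0 (a *: f).
Proof.
by move=> a0 f0 x x0; rewrite topdualZE mulr_ge0//; exact: f0.
Qed.

Fact topdual_le_norm f g :
  topdual_le (topdual_join f (- f)) (topdual_join g (- g)) -> `|f| <= `|g|.
Proof.
move=> fg; apply: opnorm_le => // x.
set af := topdual_join f (- f) in fg *; set ag := topdual_join g (- g) in fg *.
have [faf nfaf] := (topdual_leUx f (- f) af).1 (topdual_lexx _).
set X := lat_abs x.
have X0 : 0 [<=] X by exact: lat_abs_ge0.
have Xx : 0 [<=] (X - x) by apply/bsubr_ge0; exact: bleUl.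
have XNx : 0 [<=] (X + x).
  by rewrite -[x]opprK; apply/bsubr_ge0; exact: bleUr.
have fx : `|f x| <= af X.
  have := faf _ XNx; have := faf _ Xx; have := nfaf _ XNx; have := nfaf _ Xx.
  rewrite !topdualNE !(linearB f) !(linearB af) !(linearD f) !(linearD af)/=.
  by move=> h1 h2 h3 h4; rewrite ler_norml; apply/andP; split; lra.
apply: (le_trans fx); apply: (le_trans (fg _ X0)).
rewrite topdual_joinE// -(norm_lat_abs x); apply: rk_sup_le => // y y0 yX.
rewrite topdualNE -(linearB g) (le_trans (ler_norm _))//.
rewrite (le_trans (topdual_norm_ub _ _))// ler_wpM2l//.
apply: ble_norm; rewrite -!/(lat_abs _) -/X (ge0_lat_abs X0).
apply/bleUx; split; apply/bsubr_ge0.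
  by rewrite opprB addrA addrAC; apply: baddr_ge0; exact/bsubr_ge0.
by rewrite opprK addrCA subKr; exact: baddr_ge0.
Qed.

HB.instance Definition _ := isBanachLattice.Build R (topdual E)
  topdual_lexx topdual_le_anti topdual_le_trans topdual_lexI topdual_leUx
  topdual_leD2r topdual_scale_ge0 topdual_le_norm.

End TopDualLattice.

Definition weak_star_null (R : realType) (V : normedModType R)
    (f : nat -> topdual V) : Prop :=
  forall x : V, f n x @[n --> \oo] --> (0 : R).

Definition weakly_null (R : realType) (V : normedModType R)
    (u : nat -> V) : Prop :=
  forall phi : topdual V, phi (u n) @[n --> \oo] --> (0 : R).

Definition disjoint_seq (R : realType) (E : banachLatticeType R)
    (u : nat -> E) : Prop :=
  forall n m, n <> m -> lat_abs (u n) [/\] lat_abs (u m) = 0.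

Definition weak_grothendieck (R : realType) (F : banachLatticeType R) : Prop :=
  forall f : nat -> topdual F,
    disjoint_seq f -> weak_star_null f -> weakly_null f.

Definition positive_grothendieck (R : realType) (F : banachLatticeType R) : Prop :=
  forall f : nat -> topdual F,
    (forall n, 0 [<=] f n) -> weak_star_null f -> weakly_null f.

(* The norm that MathComp-Analysis puts on ['rV[R]_n] is the sup norm. *)
Definition l2norm (R : realType) (n : nat) (v : 'rV[R]_n) : R :=
  Num.sqrt (\sum_(i < n) v ord0 i ^+ 2).

Section L2Norm.
Context {R : realType} {n : nat}.
Implicit Types (u v w : 'rV[R]_n).

Lemma l2norm_ge0 v : 0 <= l2norm v. Proof. exact: sqrtr_ge0. Qed.

Lemma l2norm_sqr v : l2norm v ^+ 2 = \sum_(i < n) v ord0 i ^+ 2.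
Proof. by rewrite sqr_sqrtr// sumr_ge0// => i _; exact: sqr_ge0. Qed.

Lemma coord_le_l2norm v i : `|v ord0 i| <= l2norm v.
Proof.
rewrite -sqrtr_sqr ler_wsqrtr// (bigD1 i)//= lerDl sumr_ge0// => j _.
exact: sqr_ge0.
Qed.

Lemma l2norm_le u v :
  (forall i, `|u ord0 i| <= `|v ord0 i|) -> l2norm u <= l2norm v.
Proof.
move=> uv; apply/ler_wsqrtr/ler_sum => i _.
by rewrite -(real_normK (num_real (u _ _))) -(real_normK (num_real (v _ _))) lerXn2r ?nnegrE.
Qed.

Lemma l2norm0 : l2norm (0 : 'rV[R]_n) = 0.
Proof. by rewrite /l2norm big1 ?sqrtr0// => i _; rewrite mxE expr0n. Qed.

Lemma l2norm_eq0 v : l2norm v = 0 -> v = 0.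
Proof.
move=> v0; apply/rowP => i; rewrite mxE; apply/eqP; rewrite -normr_le0 -v0.
exact: coord_le_l2norm.
Qed.

Lemma l2normZ a v : l2norm (a *: v) = `|a| * l2norm v.
Proof.
rewrite -sqrtr_sqr /l2norm -sqrtrM ?sqr_ge0//; congr Num.sqrt.
by rewrite mulr_sumr; apply: eq_bigr => i _; rewrite mxE exprMn.
Qed.

Lemma l2_cauchy_schwarz u v :
  \sum_(i < n) u ord0 i * v ord0 i <= l2norm u * l2norm v.
Proof.
have [u0|u0] := eqVneq (l2norm u) 0.
  rewrite u0 mul0r (l2norm_eq0 u0) big1// => i _; by rewrite mxE mul0r.
have [v0|v0] := eqVneq (l2norm v) 0.
  rewrite v0 mulr0 (l2norm_eq0 v0) big1// => i _; by rewrite mxE mulr0.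
have a0 : 0 < l2norm u by rewrite lt_neqAle eq_sym u0 l2norm_ge0.
have b0 : 0 < l2norm v by rewrite lt_neqAle eq_sym v0 l2norm_ge0.
set a := l2norm u in a0 *; set b := l2norm v in b0 *.
have H : \sum_(i < n) 2 * (a * b) * (u ord0 i * v ord0 i) <=
    \sum_(i < n) (b ^+ 2 * u ord0 i ^+ 2 + a ^+ 2 * v ord0 i ^+ 2).
  apply: ler_sum => i _; rewrite -subr_ge0.
  have -> : b ^+ 2 * u ord0 i ^+ 2 + a ^+ 2 * v ord0 i ^+ 2 -
    2 * (a * b) * (u ord0 i * v ord0 i) = (b * u ord0 i - a * v ord0 i) ^+ 2 by ring.
  exact: sqr_ge0.
move: H; rewrite big_split/= -!mulr_sumr -!l2norm_sqr -/a -/b.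
have -> : b ^+ 2 * a ^+ 2 + a ^+ 2 * b ^+ 2 = 2 * (a * b) * (a * b) by ring.
by rewrite ler_pM2l// mulr_gt0// mulr_gt0.
Qed.

Lemma l2normD u v : l2norm (u + v) <= l2norm u + l2norm v.
Proof.
rewrite -(@ler_pXn2r _ 2) ?nnegrE ?addr_ge0 ?l2norm_ge0//.
rewrite l2norm_sqr sqrrD !l2norm_sqr.
have -> : \sum_(i < n) (u + v) ord0 i ^+ 2 =
    \sum_(i < n) u ord0 i ^+ 2 + (\sum_(i < n) u ord0 i * v ord0 i) *+ 2 +
    \sum_(i < n) v ord0 i ^+ 2.
  rewrite -sumrMnl -!big_split/=; apply: eq_bigr => i _.
  by rewrite mxE sqrrD.
by rewrite lerD2r lerD2l lerMn2r/= l2_cauchy_schwarz.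
Qed.

Lemma l2normN v : l2norm (- v) = l2norm v.
Proof. by rewrite -scaleN1r l2normZ normrN1 mul1r. Qed.

End L2Norm.

(* The block of index [n : nat] is [l_2^(n+1)], so that the blocks are
   [l_2^1, l_2^2, ...]. *)
Record c0_l2 (R : realType) := C0l2 {
  c0_val :> forall n : nat, 'rV[R]_n.+1 ;
  c0_valP : l2norm (c0_val n) @[n --> \oo] --> (0 : R) }.

Section C0L2Module.
Context {R : realType}.
Implicit Types (x y z : c0_l2 R).

HB.instance Definition _ := gen_eqMixin (c0_l2 R).
HB.instance Definition _ := gen_choiceMixin (c0_l2 R).

Lemma c0_ext x y : (forall n, x n = y n) -> x = y.
Proof.
case: x y => [x xP] [y yP] /= xy.
have {}xy : x = y by apply: functional_extensionality_dep.
by subst y; rewrite (Prop_irrelevance xP yP).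
Qed.

Lemma c0_dominated (v : forall n : nat, 'rV[R]_n.+1) (r : nat -> R) :
  r n @[n --> \oo] --> (0 : R) -> (forall n, l2norm (v n) <= r n) ->
  l2norm (v n) @[n --> \oo] --> (0 : R).
Proof.
move=> r0 vr; apply: (squeeze_cvgr _ (cvg_cst 0) r0).
by near=> n; rewrite vr l2norm_ge0.
Unshelve. all: by end_near. Qed.

Fact c0_zeroP : l2norm ((fun=> 0) n : 'rV[R]_n.+1) @[n --> \oo] --> (0 : R).
Proof. by under eq_fun do rewrite l2norm0; exact: cvg_cst. Qed.

Fact c0_sumP x y : (l2norm (x n) + l2norm (y n)) @[n --> \oo] --> (0 : R).
Proof. by have := cvgD (@c0_valP _ x) (@c0_valP _ y); rewrite addr0; exact. Qed.

Fact c0_addP x y : l2norm (x n + y n) @[n --> \oo] --> (0 : R).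
Proof.
apply: (@c0_dominated (fun n => x n + y n) _ (c0_sumP x y)) => n.
exact: l2normD.
Qed.

Fact c0_oppP x : l2norm (- x n) @[n --> \oo] --> (0 : R).
Proof. by under eq_fun do rewrite l2normN; exact: c0_valP. Qed.

Fact c0_scaleP a x : l2norm (a *: x n) @[n --> \oo] --> (0 : R).
Proof.
under eq_fun do rewrite l2normZ.
by have := cvgM (cvg_cst `|a|) (@c0_valP _ x); rewrite mulr0; exact.
Qed.

Definition c0_zero : c0_l2 R := @C0l2 R (fun=> 0) c0_zeroP.
Definition c0_add x y : c0_l2 R := @C0l2 R (fun n => x n + y n) (c0_addP x y).
Definition c0_opp x : c0_l2 R := @C0l2 R (fun n => - x n) (c0_oppP x).
Definition c0_scale a x : c0_l2 R := @C0l2 R (fun n => a *: x n) (c0_scaleP a x).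

Fact c0_addA : associative c0_add.
Proof. by move=> x y z; apply: c0_ext => n; exact: addrA. Qed.
Fact c0_addC : commutative c0_add.
Proof. by move=> x y; apply: c0_ext => n; exact: addrC. Qed.
Fact c0_add0 : left_id c0_zero c0_add.
Proof. by move=> x; apply: c0_ext => n; exact: add0r. Qed.
Fact c0_addN : left_inverse c0_zero c0_opp c0_add.
Proof. by move=> x; apply: c0_ext => n; exact: addNr. Qed.

HB.instance Definition _ := GRing.isZmodule.Build (c0_l2 R)
  c0_addA c0_addC c0_add0 c0_addN.

Fact c0_scaleA a b x : c0_scale a (c0_scale b x) = c0_scale (a * b) x.
Proof. by apply: c0_ext => n; exact: scalerA. Qed.
Fact c0_scale1 : left_id 1 c0_scale.
Proof. by move=> x; apply: c0_ext => n; exact: scale1r. Qed.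
Fact c0_scaleDr : right_distributive c0_scale +%R.
Proof. by move=> a x y; apply: c0_ext => n; exact: scalerDr. Qed.
Fact c0_scaleDl x : {morph c0_scale^~ x : a b / a + b}.
Proof. by move=> a b; apply: c0_ext => n; exact: scalerDl. Qed.

HB.instance Definition _ := GRing.Zmodule_isLmodule.Build R (c0_l2 R)
  c0_scaleA c0_scale1 c0_scaleDr c0_scaleDl.

Lemma c0DE x y n : (x + y) n = x n + y n. Proof. by []. Qed.
Lemma c0NE x n : (- x) n = - x n. Proof. by []. Qed.
Lemma c0ZE a x n : (a *: x) n = a *: x n. Proof. by []. Qed.
Lemma c00E n : (0 : c0_l2 R) n = 0. Proof. by []. Qed.

Definition c0_norm x : R := sup (range (fun n => l2norm (x n))).

Lemma c0_norm_has_sup x : has_sup (range (fun n => l2norm (x n))).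
Proof.
split; first by exists (l2norm (x 0%N)), 0%N.
have /cvg_seq_bounded : cvgn (fun n => l2norm (x n)).
  by apply/cvg_ex; exists 0; exact: c0_valP.
move=> /pinfty_ex_gt0[M _ HM]; exists M => _ [n _ <-].
by apply: le_trans (ler_norm _) _; exact: HM.
Qed.

Lemma c0_norm_ub x n : l2norm (x n) <= c0_norm x.
Proof. by apply: (sup_upper_bound (c0_norm_has_sup x)); exists n. Qed.

Lemma c0_norm_le x (C : R) : (forall n, l2norm (x n) <= C) -> c0_norm x <= C.
Proof.
move=> xC; apply: ge_sup; first by case: (c0_norm_has_sup x).
by move=> _ [n _ <-].
Qed.

Lemma c0_norm_ge0 x : 0 <= c0_norm x.
Proof. exact: le_trans (l2norm_ge0 _) (c0_norm_ub x 0%N). Qed.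

Fact c0_normD x y : c0_norm (x + y) <= c0_norm x + c0_norm y.
Proof.
apply: c0_norm_le => n; rewrite c0DE (le_trans (l2normD _ _))// lerD//.
  exact: c0_norm_ub.
exact: c0_norm_ub.
Qed.

Fact c0_norm_eq0 x : c0_norm x = 0 -> x = 0.
Proof.
move=> x0; apply: c0_ext => n; apply: l2norm_eq0; apply/eqP.
by rewrite eq_le l2norm_ge0 andbT -x0 c0_norm_ub.
Qed.

Fact c0_normZ a x : c0_norm (a *: x) = `|a| * c0_norm x.
Proof.
have H b y : c0_norm (b *: y) <= `|b| * c0_norm y.
  by apply: c0_norm_le => n; rewrite c0ZE l2normZ ler_wpM2l// c0_norm_ub.
have [->|a0] := eqVneq a 0.
  apply/eqP; rewrite normr0 mul0r eq_le c0_norm_ge0 andbT.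
  by rewrite (le_trans (H _ _))// normr0 mul0r.
apply/eqP; rewrite eq_le H/= -ler_pdivlMl ?normr_gt0//.
rewrite -[in leLHS](scale1r x) -(mulVf a0) -scalerA.
by rewrite (le_trans (H _ _))// normfV.
Qed.

HB.instance Definition _ :=
  Lmodule_isNormed.Build R (c0_l2 R) c0_normD c0_normZ c0_norm_eq0.

Lemma c0_normE x : `|x| = c0_norm x. Proof. by []. Qed.

Fact c0_complete (F : set_system (c0_l2 R)) :
  ProperFilter F -> cauchy F -> cvg F.
Proof.
move=> FF /cauchy_ballP Fc.
have Fc2 (e : R) : 0 < e -> \forall x \near F, \forall y \near F, `|x - y| < e.
  move=> e0; have := Fc e e0 => /nearP_dep.
  by apply: filterS => f; apply: filterS.
have ptw (k : {n : nat & 'I_n.+1}) :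
    exists l : R, (fun x : c0_l2 R => x (projT1 k) ord0 (projT2 k)) @ F --> l.
  case: k => n i /=.
  suff : cvg ((fun x : c0_l2 R => x n ord0 i) @ F) by move=> /cvg_ex.
  apply/cauchy_cvgP/cauchyP => e e0.
  have [x Fx] := (cauchyP _).1 ((cauchy_ballP _).1 Fc) _ e0.
  exists (x n ord0 i); apply: (filterS (P := ball x e)) Fx => y xy.
  rewrite /= /ball/= (_ : _ - _ = (x - y) n ord0 i); last by rewrite !mxE.
  by apply: le_lt_trans xy; exact/(le_trans (coord_le_l2norm _ _))/c0_norm_ub.
have [l lE] := choice ptw.
pose L (n : nat) : 'rV[R]_n.+1 := \row_i l (existT _ n i).
have Lub (e : R) : 0 < e ->
    \forall x \near F, forall n, l2norm (L n - (x : c0_l2 R) n) <= e.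
  move=> e0; have := Fc2 _ e0; apply: filterS => x xF n.
  have : (fun y : c0_l2 R => l2norm (y n - x n)) @ F --> l2norm (L n - x n).
    apply: (continuous_cvg _ (@sqrt_continuous R _)).
    apply: cvg_big => [|i _]; first exact: add_continuous.
    rewrite !mxE; under eq_fun do rewrite !mxE.
    have H : (fun y : c0_l2 R => y n ord0 i - x n ord0 i) @ F -->
        (l (existT _ n i) - x n ord0 i).
      by apply: cvgB; [exact: (lE (existT _ n i))|exact: cvg_cst].
    exact: cvgM.
  move/cvgr_to_le; apply; apply: filterS xF => y xy.
  apply: le_trans (ltW xy); rewrite -normrN opprB.
  exact: (c0_norm_ub (y - x)).
have LP : l2norm (L n) @[n --> \oo] --> (0 : R).
  apply/cvgrPdist_le => e e0.
  have e20 : 0 < e / 2 by rewrite divr_gt0.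
  have [x xL] := @filter_ex _ F _ _ (Lub _ e20).
  have /cvgrPdist_le /(_ _ e20) := c0_valP x.
  apply: filterS => n; rewrite !sub0r !normrN !ger0_norm ?l2norm_ge0// => xn.
  rewrite -(subrK (x n) (L n)) (le_trans (l2normD _ _))//.
  by rewrite [leRHS]splitr lerD.
apply/cvg_ex; exists (C0l2 LP); apply/cvgrPdist_le => e e0.
by apply: filterS (Lub e e0) => x xL; exact: c0_norm_le.
Qed.

HB.instance Definition _ := Uniform_isComplete.Build (c0_l2 R) c0_complete.

Definition c0_le x y : Prop := forall n i, x n ord0 i <= y n ord0 i.

Fact c0_map2P (op : R -> R -> R) x y :
  (forall a b, `|op a b| <= `|a| + `|b|) ->
  l2norm (\row_i op (x n ord0 i) (y n ord0 i)) @[n --> \oo] --> (0 : R).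
Proof.
move=> opP.
apply: (@c0_dominated (fun n => \row_i op (x n ord0 i) (y n ord0 i)) _ (c0_sumP x y)) => n.
pose a (v : 'rV[R]_n.+1) : 'rV[R]_n.+1 := \row_i `|v ord0 i|.
have na v : l2norm (a v) <= l2norm v by apply: l2norm_le => i; rewrite mxE normr_id.
apply: le_trans (lerD (na _) (na _)); apply: le_trans (l2normD _ _).
by apply: l2norm_le => i; rewrite !mxE [leRHS]ger0_norm ?addr_ge0.
Qed.

Fact c0_meetP x y :
  l2norm (\row_i Num.min (x n ord0 i) (y n ord0 i)) @[n --> \oo] --> (0 : R).
Proof.
by apply: c0_map2P => a b; rewrite minEle; case: ifP; rewrite (lerDl, lerDr).
Qed.

Fact c0_joinP x y :
  l2norm (\row_i Num.max (x n ord0 i) (y n ord0 i)) @[n --> \oo] --> (0 : R).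
Proof.
by apply: c0_map2P => a b; rewrite maxEle; case: ifP; rewrite (lerDl, lerDr).
Qed.

Definition c0_meet x y : c0_l2 R := @C0l2 R _ (c0_meetP x y).
Definition c0_join x y : c0_l2 R := @C0l2 R _ (c0_joinP x y).

Fact c0_lexx x : c0_le x x. Proof. by move=> n i. Qed.

Fact c0_le_anti x y : c0_le x y -> c0_le y x -> x = y.
Proof.
move=> xy yx; apply: c0_ext => n; apply/rowP => i; apply/eqP.
by rewrite eq_le xy yx.
Qed.

Fact c0_le_trans y x z : c0_le x y -> c0_le y z -> c0_le x z.
Proof. by move=> xy yz n i; exact: le_trans (xy n i) (yz n i). Qed.

Fact c0_lexI x y z : c0_le z (c0_meet x y) <-> c0_le z x /\ c0_le z y.
Proof.
split=> [H|[zx zy] n i]; last by rewrite mxE le_min zx zy.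
by split=> n i; have := H n i; rewrite mxE le_min => /andP[].
Qed.

Fact c0_leUx x y z : c0_le (c0_join x y) z <-> c0_le x z /\ c0_le y z.
Proof.
split=> [H|[zx zy] n i]; last by rewrite mxE ge_max zx zy.
by split=> n i; have := H n i; rewrite mxE ge_max => /andP[].
Qed.

Fact c0_leD2r z x y : c0_le x y -> c0_le (x + z) (y + z).
Proof. by move=> xy n i; rewrite !c0DE !mxE lerD2r; exact: xy. Qed.

Fact c0_scale_ge0 (a : R) x : 0 <= a -> c0_le 0 x -> c0_le 0 (a *: x).
Proof.
by move=> a0 x0 n i; have := x0 n i; rewrite !mxE => xn; rewrite mulr_ge0.
Qed.

Fact c0_le_norm x y :
  c0_le (c0_join x (- x)) (c0_join y (- y)) -> `|x| <= `|y|.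
Proof.
move=> xy; apply: c0_norm_le => n; apply: le_trans (c0_norm_ub y n).
by apply: l2norm_le => i; have := xy n i; rewrite !mxE !maxrN.
Qed.

HB.instance Definition _ := isBanachLattice.Build R (c0_l2 R)
  c0_lexx c0_le_anti c0_le_trans c0_lexI c0_leUx c0_leD2r c0_scale_ge0 c0_le_norm.

End C0L2Module.

(* Main.v *)
Require Import Defs.
From mathcomp Require Import reals.
From HB Require Import structures.
From mathcomp Require Import all_boot all_order all_algebra.
From mathcomp Require Import all_classical all_analysis.

(** The unit vectors of the first coordinates of the blocks span a copy of
    [c_0] in [E] on which the first-coordinate functionals [f_n x = x_n(0)] act
    as the unit vectors of [l_1].  They are positive and disjoint, and weak*
    null because the block norms of [x] tend to [0].  Summation against
    [(1, 1, ...)], i.e. [g |-> \sum_n g(e_n)], is bounded on [E'] since every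
    finite sum of terms [e_n] or [- e_n] has norm at most [1]; it maps each
    [f_n] to [1], so [f_n] is not weakly null. *)

Set Implicit Arguments.
Unset Strict Implicit.
Unset Printing Implicit Defensive.

Import Order.TTheory GRing.Theory Num.Theory.
Import numFieldNormedType.Exports.

Local Open Scope classical_set_scope.
Local Open Scope ring_scope.

Section FirstCoordinates.
Context {R : realType}.
Implicit Types (x : c0_l2 R) (g : topdual (c0_l2 R)) (n m k : nat).

Definition first_coord n x : R^o := x n ord0 ord0.

Fact first_coord_linear n : linear (first_coord n).
Proof. by move=> a x y; rewrite /first_coord c0DE c0ZE !mxE. Qed.

HB.instance Definition _ n :=
  GRing.isLinear.Build R (c0_l2 R) R^o *:%R (first_coord n)
    (first_coord_linear n).

Fact first_coord_continuous n : continuous (first_coord n).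
Proof.
apply/linear_continuousP; exists 1 => x; rewrite mul1r.
exact: le_trans (coord_le_l2norm _ _) (c0_norm_ub x n).
Qed.

Definition first_coordf n : topdual (c0_l2 R) :=
  Topdual (@first_coord_continuous n).

Lemma first_coordfE n x : first_coordf n x = x n ord0 ord0.
Proof. by []. Qed.

Lemma first_coordf_ge0 n : 0 [<=] first_coordf n.
Proof. by move=> x /(_ n ord0); rewrite c00E mxE. Qed.

Lemma first_coordf_weak_star_null : weak_star_null first_coordf.
Proof.
move=> x; apply/norm_cvg0P; apply: (squeeze_cvgr _ (cvg_cst 0) (@c0_valP _ x)).
by near=> n; rewrite normr_ge0/= coord_le_l2norm.
Unshelve. all: by end_near. Qed.

Lemma l2norm_delta0 n (a : R) : l2norm (a *: delta_mx ord0 ord0 : 'rV[R]_n.+1) = `|a|.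
Proof.
rewrite l2normZ /l2norm big_ord_recl big1 => [|i _]; rewrite !mxE ?eqxx/=.
  by rewrite expr1n addr0 sqrtr1 mulr1.
by rewrite expr0n.
Qed.

(** The 0/1 coefficient selects block [n] without a cast between the row types of different
    blocks. *)
Fact first_vec_c0 n :
  l2norm ((k == n)%:R *: delta_mx ord0 ord0 : 'rV[R]_k.+1) @[k --> \oo] --> (0 : R).
Proof.
apply: cvg_near_cst; near=> k; rewrite l2norm_delta0 gtn_eqF ?normr0//.
by near: k; exact: nbhs_infty_gt.
Unshelve. all: by end_near. Qed.

Definition first_vec n : c0_l2 R := C0l2 (first_vec_c0 n).

Lemma first_vecE n k i : first_vec n k ord0 i = ((k == n) && (i == ord0))%:R.
Proof. by rewrite !mxE/= -natrM mulnb. Qed.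

Lemma first_coordf_vec n m : first_coordf n (first_vec m) = (n == m)%:R.
Proof. by rewrite first_coordfE first_vecE eqxx andbT. Qed.

(** The two functionals live on complementary parts of a positive [x]: a common lower bound is
    tested against [first_coordf n] on one part and against [first_coordf m] on the other. *)
Lemma first_coordf_disjoint : disjoint_seq first_coordf.
Proof.
move=> n m /eqP nm; rewrite !ge0_lat_abs; try exact: first_coordf_ge0.
apply: ble_anti; last by apply/blexI; split; exact: first_coordf_ge0.
have := bleIr (first_coordf n) (first_coordf m).
have := bleIl (first_coordf n) (first_coordf m).
move: (_ [/\] _) => h hn hm x x0.
(* [u] keeps only entry 0 of block [n] of [x]. Both [u] and [x - u] are positive, [first_coordf n]
   vanishes on [x - u] and [first_coordf m] on [u], so [h x <= 0]. *)
pose u := first_coordf n x *: first_vec n.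
have uE k i : u k ord0 i = x n ord0 ord0 * ((k == n) && (i == ord0))%:R.
  by rewrite c0ZE mxE first_coordfE first_vecE.
have xn0 : 0 <= x n ord0 ord0 := first_coordf_ge0 n x0.
have u0 : 0 [<=] u by move=> k i; rewrite uE c00E mxE mulr_ge0.
have xu0 : 0 [<=] (x - u).
  move=> k i; rewrite c00E c0DE c0NE [leRHS]mxE [in leRHS]mxE uE.
  have := x0 k i; rewrite c00E !mxE.
  have [kn|] := eqVneq k n; last by rewrite mulr0 subr0.
  subst k; have [->|] := eqVneq i ord0; last by rewrite mulr0 subr0.
  by rewrite mulr1 subrr.
rewrite -[x in h x](subrK u) linearD/= -[leRHS](addr0 (0 : R)) lerD//.
  apply: le_trans (hn _ xu0) _.
  by rewrite linearB/= /u linearZ/= first_coordf_vec eqxx [_ *: _]mulr1 subrr.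
apply: le_trans (hm _ u0) _.
by rewrite linearZ/= first_coordf_vec eq_sym (negbTE nm) [_ *: _]mulr0.
Qed.

(** The terms occupy different blocks, so the sup norm of the sum is the largest [|a k|], whatever
    the number of terms. *)
Lemma norm_sum_first_vec (a : nat -> R) n :
  (forall k, `|a k| <= 1) -> `|\sum_(0 <= k < n) a k *: first_vec k| <= 1.
Proof.
move=> a1; apply: c0_norm_le => k.
suff -> : (\sum_(0 <= j < n) a j *: first_vec j) k =
    (if (k < n)%N then a k else 0) *: delta_mx ord0 ord0.
  by rewrite l2norm_delta0; case: ifP; rewrite ?normr0.
elim: n => [|n IHn]; first by rewrite big_nil scale0r.
rewrite big_nat_recr// [LHS]c0DE c0ZE IHn ltnS scalerA -scalerDl.
by congr (_ *: _); case: ltngtP => [||->]; rewrite ?mulr0 ?addr0 ?add0r ?mulr1.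
Qed.

Lemma sum_norm_first_vec g n : \sum_(0 <= k < n) `|g (first_vec k)| <= `|g|.
Proof.
(* The signs turn the sum of absolute values into one value of [g], at a vector of norm at most
   1. *)
pose a k : R := Num.sg (g (first_vec k)).
have a1 k : `|a k| <= 1 by rewrite /a normr_sg lern1 leq_b1.
have -> : \sum_(0 <= k < n) `|g (first_vec k)| =
    g (\sum_(0 <= k < n) a k *: first_vec k).
  rewrite linear_sum; apply: eq_bigr => k _.
  by rewrite linearZ/=; exact: normrEsg.
apply: le_trans (ler_norm _) _; apply: le_trans (topdual_norm_ub _ _) _.
by rewrite ler_piMr// norm_sum_first_vec.
Qed.

Lemma is_cvg_series_first_vec g : cvgn (series (fun k => g (first_vec k))).
Proof.
apply: normed_cvg; apply: nondecreasing_is_cvgn.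
  by apply: nondecreasing_series => n _ _; exact: normr_ge0.
by exists `|g| => _ [n _ <-]; exact: sum_norm_first_vec.
Qed.

(** As an element of the bidual, the l_infinity sum of the blocks, this is the sequence whose every
    block is the first unit vector. *)
Definition first_sum g : R^o := limn (series (fun k => g (first_vec k))).

Fact first_sum_linear : linear first_sum.
Proof.
move=> a g h; apply: cvg_lim => //.
rewrite (_ : series _ = (fun n => a * series (fun k => g (first_vec k)) n +
    series (fun k => h (first_vec k)) n)); last first.
  by apply/funext => n; rewrite /series/= mulr_sumr -big_split.
apply: cvgD; last exact: is_cvg_series_first_vec.
by apply: cvgM; [exact: cvg_cst|exact: is_cvg_series_first_vec].
Qed.

HB.instance Definition _ :=
  GRing.isLinear.Build R (topdual (c0_l2 R)) R^o *:%R first_sum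
    first_sum_linear.

Fact first_sum_continuous : continuous first_sum.
Proof.
apply/linear_continuousP; exists 1 => g; rewrite mul1r.
have /cvg_norm/cvgr_to_le := @is_cvg_series_first_vec g; apply.
(* Every partial sum is bounded by [|g|], hence so is the limit. *)
near=> n; apply: le_trans (sum_norm_first_vec g n).
exact: ler_norm_sum.
Unshelve. all: by end_near. Qed.

Definition first_sumf : topdual (topdual (c0_l2 R)) :=
  Topdual first_sum_continuous.

Lemma first_sumf_coord n : first_sumf (first_coordf n) = 1.
Proof.
(* The [k]-th partial sum runs over indices below [k], so it equals 1 once [k > n]. *)
apply: cvg_lim => //; apply: cvg_near_cst; near=> k; rewrite /series/=.
under eq_bigr do rewrite first_coordf_vec.
rewrite (bigD1_seq n) ?iota_uniq//=; last first.
  by rewrite mem_index_iota/=; near: k; exact: nbhs_infty_gt.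
by rewrite eqxx big1 ?addr0// => i /negbTE; rewrite eq_sym => ->.
Unshelve. all: by end_near. Qed.

Lemma first_coordf_not_weakly_null : ~ weakly_null first_coordf.
Proof.
move=> /(_ first_sumf); under eq_fun do rewrite first_sumf_coord.
move/(cvg_unique _ (cvg_cst (1 : R))) => /(_ (@norm_hausdorff _ _))/eqP.
by rewrite oner_eq0.
Qed.

End FirstCoordinates.

Theorem proposition2p7 (R : realType) :
  ~ weak_grothendieck (c0_l2 R) /\ ~ positive_grothendieck (c0_l2 R).
Proof.
split=> H; apply: (@first_coordf_not_weakly_null R); apply: H.
- exact: first_coordf_disjoint.
- exact: first_coordf_weak_star_null.
- exact: first_coordf_ge0.
- exact: first_coordf_weak_star_null.
Qed.
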